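(* Let $H$ be any graph, let $X\in\{P_n,C_n,K_n,S_{n+1},K_{u,v}\}$ (with parameters for which the respective graph is defined), and let $S=K[V(X\odot H)]$. Then $S/I(X\odot H)$ is Cohen–Macaulay if and only if $H$ is a complete graph.
   Context: $K$ is a field. All graphs are finite, simple, have nonempty vertex set, and may have isolated vertices. Vertices of a graph $G$ are identified with the variables of the standard graded polynomial ring $K[V(G)]$. The corona product $X\odot H$ is the graph obtained from one copy of $X$ and $|V(X)|$ disjoint copies of $H$, namely $H_1,\dots,H_{|V(X)|}$, by joining the $i$-th vertex of $X$ to every vertex of $H_i$. It has no isolated vertices, and $I(X\odot H)\subset S$ is its usual edge ideal, generated by all products $xy$ with $\{x,y\}$ an edge. Graphs: $P_n$ ($n\ge1$) is the path on $n$ vertices; $C_n$ ($n\geq3$) is the cycle on $n$ vertices; $K_n$ ($n\ge1$) is the complete graph on $n$ vertices (the one-vertex graph $K_1$ is complete); $S_k$ ($k\geq1$) is the $k$-star, i.e. the tree on $k+1$ vertices consisting of one vertex joined to each of $k$ other vertices; $K_{u,v}$ ($u,v\geq1$) is the complete bipartite graph with partite sets of sizes $u$ and $v$. $S/I(X\odot H)$ is Cohen–Macaulay if $\operatorname{depth}(S/I(X\odot H))=\dim(S/I(X\odot H))$, depth being taken with respect to the graded maximal ideal of $S$. *)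

(* Defs.v *)
From HB Require Import structures.
From mathcomp Require Import all_boot all_order all_algebra ring_quotient.
From mathcomp Require Import boolp.
From mathcomp Require Import mpoly.

Set Implicit Arguments.
Unset Strict Implicit.
Unset Printing Implicit Defensive.

Import GRing.Theory.

Local Open Scope ring_scope.
Local Open Scope quotient_scope.

Record graph := Graph {
  vertex :> finType;
  adj : rel vertex;
  adj_sym : ssrbool.symmetric adj;
  adj_irr : irreflexive adj
}.

Definition isomorphic (G H : graph) : Prop :=
  exists2 f : G -> H, bijective f & forall x y, adj (f x) (f y) = adj x y.

Definition is_complete (G : graph) : Prop :=
  forall x y : G, x != y -> adj x y.

Section SymmetricClosure.
Variables (T : finType) (r : rel T).

Let e : rel T := fun x y => (x != y) && (r x y || r y x).

Fact simple_sym : ssrbool.symmetric e.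
Proof. by move=> x y; rewrite /e eq_sym orbC. Qed.

Fact simple_irr : irreflexive e.
Proof. by move=> x; rewrite /e eqxx. Qed.

Definition simple_graph : graph := Graph simple_sym simple_irr.
End SymmetricClosure.

Definition path_graph n : graph :=
  simple_graph (fun i j : 'I_n => j == i.+1 :> nat).

(* The n-cycle for n >= 3; smaller n degenerate to paths. *)
Definition cycle_graph n : graph :=
  simple_graph (fun i j : 'I_n => j == (i.+1 %% n)%N :> nat).

Definition complete_graph n : graph :=
  simple_graph (fun _ _ : 'I_n => true).

(* [None] is the centre, [Some i] are the k leaves. *)
Definition star_graph k : graph :=
  simple_graph (fun x y : option 'I_k => (x == None) && (y != None)).

Definition complete_bipartite_graph u v : graph :=
  simple_graph (fun x y : 'I_u + 'I_v =>
    if (x, y) is (inl _, inr _) then true else false).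

Variant special_graph (X : graph) : Prop :=
  | SpecialPath n of (1 <= n)%N & isomorphic X (path_graph n)
  | SpecialCycle n of (3 <= n)%N & isomorphic X (cycle_graph n)
  | SpecialComplete n of (1 <= n)%N & isomorphic X (complete_graph n)
  | SpecialStar n of isomorphic X (star_graph n.+1)
  | SpecialBipartite u v of (1 <= u)%N & (1 <= v)%N
      & isomorphic X (complete_bipartite_graph u v).

(* [inl x] is the vertex x of X, and [inr (x, h)] is the vertex h of the copy
   of H attached to x. *)
Section Corona.
Variables X H : graph.

Definition corona_adj : rel (X + X * H) := fun a b =>
  match a, b with
  | inl x, inl y => adj x y
  | inl x, inr (y, _) | inr (y, _), inl x => x == y
  | inr (x, h), inr (y, k) => (x == y) && adj h k
  end.

Fact corona_sym : ssrbool.symmetric corona_adj.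
Proof.
by move=> [x|[x h]] [y|[y k]] //=; [apply: adj_sym | rewrite eq_sym adj_sym].
Qed.

Fact corona_irr : irreflexive corona_adj.
Proof. by move=> [x|[x h]] /=; rewrite ?eqxx adj_irr. Qed.

Definition corona : graph := Graph corona_sym corona_irr.
End Corona.

Section GeneratedIdeal.
Variables (R : comNzRingType) (G : R -> Prop).

Definition gen_ideal : {pred R} := fun p =>
  `[< exists s : seq (R * R),
        (forall ag, ag \in s -> G ag.2) /\ p = \sum_(ag <- s) ag.1 * ag.2 >].

Fact gen_ideal_closed : 1 \notin gen_ideal -> idealr_closed gen_ideal.
Proof.
move=> n1; split=> // [|a u v].
  by apply/asboolP; exists [::]; rewrite big_nil.
move=> /asboolP[s [sG ->]] /asboolP[t [tG ->]]; apply/asboolP.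
exists ([seq (a * i.1, i.2) | i <- s] ++ t); split.
  by move=> i; rewrite mem_cat => /orP[/mapP[j js ->]|/tG //]; apply: (sG j js).
rewrite big_cat big_map /= mulr_sumr; congr (_ + _).
by apply: eq_bigr => i _; rewrite mulrA.
Qed.
End GeneratedIdeal.

Section QuotientModule.
Variables (R : comNzRingType) (I : idealr R).

Let scale (a : R) (x : {ideal_quot I}) : {ideal_quot I} :=
  \pi_{ideal_quot I} a * x.

Fact quot_scalerA a b x : scale a (scale b x) = scale (a * b) x.
Proof. by rewrite /scale mulrA rmorphM. Qed.

Fact quot_scale1r : left_id 1 scale.
Proof. by move=> x; rewrite /scale rmorph1 mul1r. Qed.

Fact quot_scalerDr : right_distributive scale +%R.
Proof. by move=> a x y; rewrite /scale mulrDr. Qed.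

Fact quot_scalerDl x : {morph scale^~ x : a b / a + b}.
Proof. by move=> a b; rewrite /scale rmorphD mulrDl. Qed.

HB.instance Definition _ :=
  GRing.Zmodule_isLmodule.Build R {ideal_quot I}
    quot_scalerA quot_scale1r quot_scalerDr quot_scalerDl.
End QuotientModule.

Section Depth.
Variables (R : comNzRingType) (M : lmodType R).

(* x belongs to (s_0, ..., s_(k-1)) M *)
Definition in_seq_submod (s : seq R) (x : M) : Prop :=
  exists m : nat -> M, x = \sum_(i < size s) s`_i *: m i.

Definition regular_seq (s : seq R) : Prop :=
  (forall i, (i < size s)%N -> forall x : M,
     in_seq_submod (take i s) (s`_i *: x) -> in_seq_submod (take i s) x)
  /\ (exists x : M, ~ in_seq_submod s x).

(* d is the maximal length of an M-regular sequence contained in m. *)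
Definition is_depth (m : {pred R}) (d : nat) : Prop :=
  (exists s : seq R, [/\ {subset s <= m}, regular_seq s & size s = d])
  /\ (forall s : seq R, {subset s <= m} -> regular_seq s -> (size s <= d)%N).
End Depth.

(* Membership in a [prime_idealr] is boolean; since every proposition is
   decidable by [asbool], chains range over all prime ideals of A. *)
Section KrullDimension.
Variable A : comNzRingType.

Definition prime_chain (n : nat) (P : 'I_n.+1 -> prime_idealr A) : Prop :=
  forall i j : 'I_n.+1, (i < j)%N ->
    {subset P i <= P j} /\ exists2 a, a \in P j & a \notin P i.

Definition is_krull_dim (d : nat) : Prop :=
  (exists P : 'I_d.+1 -> prime_idealr A, prime_chain P)
  /\ (forall n (P : 'I_n.+1 -> prime_idealr A), prime_chain P -> (n <= d)%N).
End KrullDimension.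

Section EdgeIdeal.
Variables (K : fieldType) (G : graph).

(* K[V(G)]; the variable of v is indexed by its rank in the enumeration of
   V(G). *)
Local Notation vertex_ring := {mpoly K[#|G|]}.

Definition var (v : G) : vertex_ring := 'X_(enum_rank v).

Definition irrelevant_ideal : {pred vertex_ring} :=
  gen_ideal (fun p : vertex_ring => exists v : G, p = var v).

Definition edge_ideal : {pred vertex_ring} :=
  gen_ideal (fun p : vertex_ring =>
    exists x y : G, adj x y /\ p = var x * var y).

Fact edge_ideal_proper : 1 \notin edge_ideal.
Proof.
apply/negP => /asboolP[s [sG]] /(congr1 (meval (fun _ => 0 : K))).
rewrite rmorph1 raddf_sum big_seq big1 => [/eqP|i /sG]; first by rewrite oner_eq0.
by case=> x [y [_ Ei]]; rewrite [LHS]mevalM Ei mevalM !mevalXU !mulr0.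
Qed.

HB.instance Definition _ :=
  isIdealr.Build vertex_ring edge_ideal (gen_ideal_closed edge_ideal_proper).

Definition edge_ring := {ideal_quot edge_ideal}.

HB.instance Definition _ := GRing.ComNzRing.on edge_ring.
HB.instance Definition _ := GRing.Lmodule.on edge_ring.

Definition cohen_macaulay_edge_ring : Prop :=
  exists d, is_depth edge_ring irrelevant_ideal d /\ is_krull_dim edge_ring d.
End EdgeIdeal.

(* Main.v *)
Require Import Defs.
From HB Require Import structures.
From mathcomp Require Import all_boot all_order all_algebra ring_quotient.
From mathcomp Require Import boolp mpoly.
From mathcomp Require Import ring.

(** Write I for the edge ideal of a graph G, S for the polynomial ring on its
    vertices and m for the ideal generated by the variables. Three facts about
    S / I carry the proof.

    - The dimension is the largest size of an independent set
      ([krull_dim_ge], [krull_dim_le]): an independent set W gives the chain of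
      primes generated by the variables outside W and an initial segment of W;
      conversely the variables outside the first prime of a chain form an
      independent set W, and the elements that separate the steps of the chain
      would satisfy a polynomial relation modulo the other variables if there
      were more than #|W| of them.

    - The depth is at most the size of any maximal independent set W
      ([depth_le_dominating]). The product z of the variables of W is killed by
      the prime generated by the variables outside W. Powers of a regular
      sequence are regular ([regular_over_exp]), and a nonzero polynomial
      relation f (a_1, ..., a_r) * z = 0 over the field, with a_1, ..., a_r
      regular, forces z into (a_1, ..., a_r) ([boundary_regular]). So if r
      exceeded #|W|, relations among the powers a_i ^ t would place z in
      I + m ^ t for all t, which is absurd for a monomial not in I.

    - If the vertices are partitioned into cliques, each containing a vertex
      whose neighbours all lie in the clique, then the sums of the variables
      over the cliques form a regular sequence ([regular_class_sums]). This is
      an induction through the exact sequences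
      0 -> S / (J : x) -> S / J -> S / (J + (x)) -> 0 for a variable x, whose
      outer terms correspond to graphs with fewer vertices.

    If H is complete, the corona is partitioned into the cliques made of a
    vertex of X and its copy of H, so the depth is at least #|X|; and no
    independent set has more than #|X| elements. If H has two nonadjacent
    vertices, take a maximal independent set B of H containing them, so that
    #|B| > 1. The copies of B form an independent set of size #|X| * #|B|, while
    replacing one of them by the vertex of X to which it is attached produces a
    maximal independent set of smaller size 1 + (#|X| - 1) * #|B|: the depth is
    smaller than the dimension. *)

Set Implicit Arguments.
Unset Strict Implicit.
Unset Printing Implicit Defensive.

Import GRing.Theory.

Local Open Scope ring_scope.
Local Open Scope quotient_scope.

(** * Ideals and their generators *)

Record is_ideal (R : comNzRingType) (J : R -> Prop) : Prop := IsIdeal {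
  ideal_zero : J 0;
  ideal_add x y : J x -> J y -> J (x + y);
  ideal_mul a x : J x -> J (a * x)
}.

Section Ideals.
Variable R : comNzRingType.
Implicit Types (N J : R -> Prop) (s : seq R).

Lemma ideal_mulr N a x : is_ideal N -> N x -> N (x * a).
Proof. by move=> iN Nx; rewrite mulrC; apply: ideal_mul. Qed.

Lemma ideal_opp N x : is_ideal N -> N x -> N (- x).
Proof. by move=> iN Nx; rewrite -mulN1r; apply: ideal_mul. Qed.

Lemma ideal_sub N x y : is_ideal N -> N x -> N y -> N (x - y).
Proof. by move=> iN Nx Ny; apply: ideal_add => //; apply: ideal_opp. Qed.

Lemma ideal_sum N (I : Type) (r : seq I) (P : pred I) (F : I -> R) :
  is_ideal N -> (forall i, P i -> N (F i)) -> N (\sum_(i <- r | P i) F i).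
Proof.
by move=> iN NF; apply: big_ind => //; [apply: ideal_zero | apply: ideal_add].
Qed.

Definition add_gen N a : R -> Prop := fun x => exists u, N (x - a * u).

(** The ideal N + (s), built one generator at a time so that it follows the
    recursion defining regularity. *)
Definition add_gens N s : R -> Prop := foldl add_gen N s.

Lemma add_gen_ideal N a : is_ideal N -> is_ideal (add_gen N a).
Proof.
move=> iN; split.
- by exists 0; rewrite mulr0 subr0; apply: ideal_zero.
- move=> x y [u Nu] [v Nv]; exists (u + v).
  have -> : x + y - a * (u + v) = (x - a * u) + (y - a * v) by ring.
  exact: ideal_add.
- move=> b x [u Nu]; exists (b * u).
  have -> : b * x - a * (b * u) = b * (x - a * u) by ring.
  exact: ideal_mul.
Qed.

Lemma add_gen_sub N a x : N x -> add_gen N a x.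
Proof. by move=> Nx; exists 0; rewrite mulr0 subr0. Qed.

Lemma add_gen_gen N a u : is_ideal N -> add_gen N a (a * u).
Proof. by move=> iN; exists u; rewrite subrr; apply: ideal_zero. Qed.

Lemma add_gen_min N J a : is_ideal J -> (forall x, N x -> J x) -> J a ->
  forall x, add_gen N a x -> J x.
Proof.
move=> iJ NJ Ja x [u /NJ Nu]; rewrite -(subrK (a * u) x).
by apply: ideal_add => //; apply: ideal_mulr.
Qed.

Lemma add_gens_min N J s : is_ideal J -> (forall x, N x -> J x) ->
  (forall a, a \in s -> J a) -> forall x, add_gens N s x -> J x.
Proof.
elim: s N => //= a s IH N iJ NJ Js; apply: IH => //.
  by apply: add_gen_min => //; apply: Js; rewrite mem_head.
by move=> b bs; apply: Js; rewrite inE bs orbT.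
Qed.

Lemma add_gen_congr N a b :
  is_ideal N -> N (a - b) -> add_gen N a = add_gen N b.
Proof.
move=> iN Nab; apply/funext => x; apply/propext; split=> -[u Nu]; exists u.
  have -> : x - b * u = (x - a * u) + u * (a - b) by ring.
  by apply: ideal_add => //; apply: ideal_mul.
have -> : x - a * u = (x - b * u) - u * (a - b) by ring.
by apply: ideal_sub => //; apply: ideal_mul.
Qed.

Lemma add_genAC N a b : add_gen (add_gen N a) b = add_gen (add_gen N b) a.
Proof.
apply/funext => x; apply/propext; split=> -[u [v Nuv]]; exists v, u.
  by have -> : x - a * v - b * u = x - b * u - a * v by ring.
by have -> : x - b * v - a * u = x - a * u - b * v by ring.
Qed.

Lemma add_gensP N s x : add_gens N s x <->
  exists c : nat -> R, N (x - \sum_(i < size s) s`_i * c i).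
Proof.
elim: s N x => [|a s IH] N x /=.
  split=> [Nx|[c]]; last by rewrite big_ord0 subr0.
  by exists (fun=> 0); rewrite big_ord0 subr0.
rewrite IH; split=> [[c [u Nu]]|[c Nc]].
  exists (fun i => if i is j.+1 then c j else u).
  by rewrite big_ord_recl /= opprD addrA addrAC.
exists (fun i => c i.+1), (c 0%N).
by move: Nc; rewrite big_ord_recl /= opprD addrA addrAC.
Qed.

End Ideals.

(** * Sequences regular modulo an ideal *)

Section RegularSequences.
Variable R : comNzRingType.
Implicit Types (N J : R -> Prop) (s : seq R).

(** Regularity of s on R / N, without the condition N + (s) <> R. Recursing on
    the head enlarges the ideal N, so that all quotient modules R / N are
    treated inside the fixed ring R. *)
Fixpoint regular_over N s : Prop :=
  if s is a :: s' then
    (forall x, N (a * x) -> N x) /\ regular_over (add_gen N a) s'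
  else True.

Lemma regular_over_nth N s : regular_over N s <->
  forall i, (i < size s)%N -> forall x,
    add_gens N (take i s) (s`_i * x) -> add_gens N (take i s) x.
Proof.
elim: s N => [|a s IH] N //=; split=> [[ra /IH rs] [|i] //=|r].
  by move=> lt_is; apply: rs.
split=> [|]; first exact: (r 0%N isT).
by apply/IH => i lt_is; apply: (r i.+1 lt_is).
Qed.

(** In general a permutation of a regular sequence is not regular, but moving
    the second element in front and dividing it out keeps the first one a
    nonzerodivisor: a * x = b * u makes u a multiple of a, as b is regular
    modulo a, and a can then be cancelled. *)
Lemma regular_over_exchange N a b s : is_ideal N ->
  regular_over N [:: a, b & s] -> regular_over (add_gen N b) (a :: s).
Proof.
move=> iN [ra [rb rs]]; rewrite /= add_genAC; split=> // x [u Nu].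
have [w Nw] : add_gen N a u.
  apply: rb; exists x.
  by rewrite -opprB; apply: ideal_opp.
exists w; apply: ra.
have -> : a * (x - b * w) = (a * x - b * u) + b * (u - a * w) by ring.
by apply: ideal_add => //; apply: ideal_mul.
Qed.

Lemma nonzerodivisor_exp N a t : (forall x, N (a * x) -> N x) ->
  forall x, N (a ^+ t * x) -> N x.
Proof.
move=> ra; elim: t => [|t IH] x; first by rewrite expr0 mul1r.
by rewrite exprS -mulrA => /ra; apply: IH.
Qed.

(** The point is that b stays a nonzerodivisor modulo a ^ t. This goes by
    induction on t: b * x in (a ^ t.+1) gives x = a * y, and cancelling a
    leaves b * y in (a ^ t). *)
Lemma regular_over_exp_head N a s t : is_ideal N ->
  regular_over N (a :: s) -> regular_over N (a ^+ t :: s).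
Proof.
elim: s N => [|b s IH] N iN.
  by case=> ra _; split=> //; apply: nonzerodivisor_exp.
move=> reg; have regb := regular_over_exchange iN reg.
case: reg => ra [rb _]; split; first exact: nonzerodivisor_exp.
have [|_ regt] := IH _ _ regb; first exact: add_gen_ideal.
split; last by rewrite add_genAC.
elim: t {IH regb regt} => [|t IHt] x [u].
  by exists x; rewrite expr0 mul1r subrr; apply: ideal_zero.
rewrite exprS; set c := a ^+ t in IHt *; move=> Nu.
have [y Ny] : add_gen N a x.
  apply: rb; exists (c * u).
  by have -> : b * x - a * (c * u) = b * x - a * c * u by ring.
have [w Nw] : add_gen N (c) y.
  apply: IHt; exists u; apply: ra.
  have -> : a * (b * y - c * u) = (b * x - a * c * u) - b * (x - a * y).
    by ring.
  by apply: ideal_sub => //; apply: ideal_mul.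
exists w.
have -> : x - a * c * w = (x - a * y) + a * (y - c * w) by ring.
by apply: ideal_add => //; apply: ideal_mul.
Qed.

Lemma regular_over_exp N s t : is_ideal N ->
  regular_over N s -> regular_over N [seq a ^+ t | a <- s].
Proof.
elim: s N => // a s IH N iN reg.
have /= [rt reg'] := regular_over_exp_head t iN reg.
by split=> //; apply: IH => //; apply: add_gen_ideal.
Qed.

Definition colon N x : R -> Prop := fun y => N (y * x).

(** Because a is a nonzerodivisor modulo N + (x), adding a and taking the colon
    by x commute; this carries the induction of the next lemma. *)
Lemma colon_add_gen N x a : is_ideal N ->
  (forall y, add_gen N x (a * y) -> add_gen N x y) ->
  colon (add_gen N a) x = add_gen (colon N x) a.
Proof.
move=> iN ra; apply/funext => u; apply/propext; split=> [[w Nw]|[w Nw]].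
  have [v Nv] : add_gen N x w.
    by apply: ra; exists u; rewrite -opprB [x * u]mulrC; apply: ideal_opp.
  exists v; rewrite /colon.
  have -> : (u - a * v) * x = (u * x - a * w) + a * (w - x * v) by ring.
  by apply: ideal_add => //; apply: ideal_mul.
exists (w * x); move: Nw; rewrite /colon.
by have -> : (u - a * w) * x = u * x - a * (w * x) by ring.
Qed.

(** Regularity on both ends of the exact sequence
    0 -> R / (N : x) -> R / N -> R / (N + (x)) -> 0
    passes to the middle term. *)
Lemma regular_over_colon N x s : is_ideal N ->
  regular_over (colon N x) s -> regular_over (add_gen N x) s ->
  regular_over N s.
Proof.
elim: s N => //= a s IH N iN [ca cs] [ga gs]; split.
  move=> y Nay; have [u Nu] : add_gen N x y by apply/ga/add_gen_sub.
  rewrite -(subrK (x * u) y); apply: ideal_add => //; rewrite mulrC.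
  apply: ca; rewrite /colon.
  have -> : a * u * x = a * y - a * (y - x * u) by ring.
  by apply: ideal_sub => //; apply: ideal_mul.
apply: IH; first exact: add_gen_ideal.
  by rewrite colon_add_gen.
by rewrite add_genAC.
Qed.

End RegularSequences.

(** * Krull boundary elements *)

Section KrullBoundary.
Variable R : comNzRingType.
Implicit Types (N : R -> Prop) (s : seq R).

(** The iterated Krull boundary of s = (a_1, ..., a_r): elements
    a_1 ^ m_1 * (a_2 ^ m_2 * (... (w + a_r * h_r) ...) + a_1 * h_1) with w
    invertible. Any nonzero polynomial in s with coefficients in a field has
    this shape, as one sees by factoring out the lexicographically smallest
    monomial; only the shape is used, never the polynomial. *)
Fixpoint boundary s (v : R) : Prop :=
  if s is a :: s' then
    exists m g h, boundary s' g /\ v = a ^+ m * (g + a * h)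
  else exists w, v * w = 1.

(** Cancel a ^ m, then reduce modulo a: the factor of z becomes a boundary
    element of the shorter sequence, until an invertible factor remains. *)
Lemma boundary_regular N s v z : is_ideal N ->
  regular_over N s -> boundary s v -> N (v * z) -> add_gens N s z.
Proof.
elim: s N v => [|a s IH] N v iN /=.
  by move=> _ [w vw1] Nvz; rewrite -[z]mul1r -vw1 mulrAC; apply: ideal_mulr.
move=> [ra rs] [m [g [h [bg ->]]]].
rewrite -mulrA => /(nonzerodivisor_exp ra) Ngz.
apply: IH rs bg _; first exact: add_gen_ideal.
exists (- h * z); have -> // : g * z - a * (- h * z) = (g + a * h) * z by ring.
Qed.

(** If x_i lies in P_(i+1) but not in P_i, the power of x_0 can be dropped in
    P_0 and the multiple of x_0 in P_1, so a boundary element in P_0 would put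
    an invertible element in the last prime. With algebraic dependence this
    bounds the length of chains of primes. *)
Lemma boundary_chain (P : nat -> R -> Prop) s v :
  (forall i, (i <= size s)%N -> is_ideal (P i)) ->
  (forall i, (i <= size s)%N -> ~ P i 1) ->
  (forall i x y, (i <= size s)%N -> P i (x * y) -> P i x \/ P i y) ->
  (forall i x, (i < size s)%N -> P i x -> P i.+1 x) ->
  (forall i, (i < size s)%N -> P i.+1 s`_i /\ ~ P i s`_i) ->
  boundary s v -> ~ P 0%N v.
Proof.
elim: s P v => [|a s IH] P v iP P1 Pp PS Ps /=.
  case=> w vw1 Pv; apply: (P1 0%N) => //; rewrite -vw1.
  by apply: ideal_mulr => //; apply: iP.
move=> [m [g [h [bg ->]]]] Pv.
have [P1a P0a] := Ps 0%N isT.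
have Pgh : P 0%N (g + a * h).
  elim: m Pv => [|m IHm]; first by rewrite mul1r.
  by rewrite exprS -mulrA => /Pp-/(_ isT)[//|/IHm].
have P1g : P 1%N g.
  rewrite -(addrK (a * h) g); apply: ideal_sub; first exact: iP.
    exact: PS.
  by apply: ideal_mulr => //; apply: iP.
apply: (IH (fun i => P i.+1)) bg P1g.
- by move=> i lt_is; apply: iP.
- by move=> i lt_is; apply: P1.
- by move=> i x y lt_is; apply: Pp.
- by move=> i x lt_is; apply: PS.
- by move=> i lt_is; apply: (Ps i.+1).
Qed.

End KrullBoundary.

(** * Monomial ideals *)

Section MonomialSupport.
Variables (K : fieldType) (n : nat).
Local Notation S := {mpoly K[n]}.
Implicit Types (B : pred 'X_{1..n}) (p q : S) (m : 'X_{1..n}).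

Definition supported B p : Prop := forall m, m \in msupp p -> B m.

Lemma supported0 B : supported B 0.
Proof. by move=> m; rewrite msupp0. Qed.

Lemma supportedD B p q : supported B p -> supported B q -> supported B (p + q).
Proof. by move=> Bp Bq m /msuppD_le; rewrite mem_cat => /orP[/Bp|/Bq]. Qed.

Lemma supportedB B p q : supported B p -> supported B q -> supported B (p - q).
Proof. by move=> Bp Bq m /msuppB_le; rewrite mem_cat => /orP[/Bp|/Bq]. Qed.

Lemma supportedZ B c p : supported B p -> supported B (c *: p).
Proof. by move=> Bp m /msuppZ_le /Bp. Qed.

Lemma supportedX B m : supported B 'X_[m] <-> B m.
Proof.
split=> [|Bm m']; first by apply; rewrite msuppX mem_head.
by rewrite msuppX inE => /eqP ->.
Qed.

Lemma supportedM B1 B2 B p q :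
  (forall m1 m2, B1 m1 -> B2 m2 -> B (m1 + m2)%MM) ->
  supported B1 p -> supported B2 q -> supported B (p * q).
Proof.
move=> BD Bp Bq m /msuppM_le /allpairsP[[m1 m2] [/Bp B1m /Bq B2m ->]].
exact: BD.
Qed.

Definition up_closed B := forall m m', B m -> B (m' + m)%MM.

Lemma supported_ideal B : up_closed B -> is_ideal (supported B).
Proof.
move=> upB; split; [exact: supported0 | exact: supportedD | move=> a p Bp].
by apply: (supportedM (B1 := predT) (B2 := B)) => // m1 m2 _; apply: upB.
Qed.

Lemma supported_generated B (J : S -> Prop) : is_ideal J ->
  (forall m, B m -> J 'X_[m]) -> forall p, supported B p -> J p.
Proof.
move=> iJ BJ p Bp; rewrite (mpolyE p) big_seq; apply: ideal_sum => // m /Bp Bm.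
by rewrite -mul_mpolyC; apply: ideal_mul => //; apply: BJ.
Qed.

Lemma supported_split B p :
  exists p1 p2, [/\ p = p1 + p2, supported B p1 & supported (predC B) p2].
Proof.
elim/mpolyind: p => [|c m p _ _ [p1 [p2 [-> Bp1 Bp2]]]].
  by exists 0, 0; rewrite addr0; split=> //; apply: supported0.
have [Bm|nBm] := boolP (B m).
  exists (c *: 'X_[m] + p1), p2; rewrite addrA; split=> //.
  by apply: supportedD => //; apply/supportedZ/supportedX.
exists p1, (c *: 'X_[m] + p2); rewrite addrCA; split=> //.
by apply: supportedD => //; apply/supportedZ/supportedX.
Qed.

(** Monomials outside B are closed under products, so the parts of p and q
    without monomials of B have a product without monomials of B; if both parts
    were nonzero, the product would be nonzero and congruent to p * q. *)
Lemma supported_prime B p q : up_closed B ->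
  (forall m1 m2, ~~ B m1 -> ~~ B m2 -> ~~ B (m1 + m2)%MM) ->
  supported B (p * q) -> supported B p \/ supported B q.
Proof.
move=> upB BD Bpq; have iB := supported_ideal upB.
have [p1 [p2 [def_p Bp1 Bp2]]] := supported_split B p.
have [q1 [q2 [def_q Bq1 Bq2]]] := supported_split B q.
have Bpq2 : supported B (p2 * q2).
  have -> : p2 * q2 = p * q - (p1 * q + p2 * q1) by rewrite def_p def_q; ring.
  apply: supportedB => //; apply: (ideal_add iB); last exact: (ideal_mul iB).
  exact: (ideal_mulr _ iB).
have nBpq2 : supported (predC B) (p2 * q2) by apply: supportedM Bp2 Bq2.
have /eqP : p2 * q2 = 0.
  apply/eqP; rewrite -msupp_eq0; case def_s: (msupp _) => [//|m s].
  have m_in : m \in msupp (p2 * q2) by rewrite def_s mem_head.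
  by have := nBpq2 m m_in; rewrite /= Bpq2.
by rewrite mulf_eq0 => /orP[] /eqP p0; [left|right];
  rewrite ?def_p ?def_q p0 addr0.
Qed.

End MonomialSupport.

(** * Algebraic dependence by counting monomials *)

Section BoundarySums.
Variables (K : fieldType) (S : comNzRingType) (phi : {rmorphism K -> S}).

Fixpoint exponents r N : seq (seq nat) :=
  if r is r'.+1 then [seq i :: e | i <- iota 0 N, e <- exponents r' N]
  else [:: [::]].

Fixpoint power_product (s : seq S) (e : seq nat) : S :=
  if (s, e) is (a :: s', i :: e') then a ^+ i * power_product s' e' else 1.

Lemma size_exponents r N : size (exponents r N) = (N ^ r)%N.
Proof. by elim: r => //= r IH; rewrite size_allpairs IH size_iota expnS. Qed.

Lemma exponents_uniq r N : uniq (exponents r N).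
Proof.
elim: r => //= r IH; apply: allpairs_uniq => //; first exact: iota_uniq.
by move=> [i e] [j f] _ _ [-> ->].
Qed.

Lemma lowest_power a (T : nat -> S) N m : (m < N)%N ->
  (forall i, (i < m)%N -> T i = 0) ->
  exists h, \sum_(i <- iota 0 N) a ^+ i * T i = a ^+ m * (T m + a * h).
Proof.
move=> lt_mN T0; exists (\sum_(m.+1 <= i < N) a ^+ (i - m.+1) * T i).
have -> : \sum_(i <- iota 0 N) a ^+ i * T i = \sum_(0 <= i < N) a ^+ i * T i.
  by rewrite /index_iota subn0.
rewrite (@big_cat_nat _ _ _ m) ?(ltnW lt_mN) //= big_nat.
rewrite big1 ?add0r; last first.
  by move=> i /andP[_ /T0 ->]; rewrite mulr0.
rewrite big_ltn // mulrDr; congr (_ + _).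
rewrite !mulr_sumr; apply: eq_big_nat => i /andP[lt_mi _].
by rewrite !mulrA -exprSr -exprD subnKC.
Qed.

(** Group the terms by the exponent of the first element and factor out its
    smallest power with a nonzero coefficient; by induction the cofactor of
    that power is a boundary element of the tail. *)
Lemma boundary_sum s N (c : seq nat -> K) :
  (exists2 e, e \in exponents (size s) N & c e != 0) ->
  boundary s (\sum_(e <- exponents (size s) N) phi (c e) * power_product s e).
Proof.
elim: s c => [|a s IH] c /=.
  case=> e; rewrite inE => /eqP -> c0; exists (phi (c [::])^-1).
  by rewrite big_seq1 mulr1 -rmorphM divff ?rmorph1.
case=> _ /allpairsP[[i e] [iN eE ->]] /= cie.
pose nz j := has (fun e => c (j :: e) != 0) (exponents (size s) N).
have ex_nz : exists j, nz j by exists i; apply/hasP; exists e.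
have [m /hasP[f fE cf] min_m] := ex_minnP ex_nz.
have lt_mN : (m < N)%N.
  apply: leq_ltn_trans (min_m i _) _; first by apply/hasP; exists e.
  by move: iN; rewrite mem_iota.
pose T j :=
  \sum_(e <- exponents (size s) N) phi (c (j :: e)) * power_product s e.
have -> : \sum_(e <- [seq i :: e | i <- iota 0 N, e <- exponents (size s) N])
    phi (c e) * power_product (a :: s) e = \sum_(j <- iota 0 N) a ^+ j * T j.
  transitivity (\sum_(j <- iota 0 N) \sum_(g <- exponents (size s) N)
      phi (c (j :: g)) * power_product (a :: s) (j :: g)).
    exact: big_allpairs_dep.
  apply: eq_bigr => j _; rewrite /T mulr_sumr.
  by apply: eq_bigr => g _; rewrite /= mulrCA.
have [|h ->] := lowest_power a (T := T) lt_mN.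
  move=> j lt_jm; apply: big1_seq => g /= gE.
  have /hasPn/(_ _ gE) : ~~ nz j by apply/negP=> /min_m; rewrite leqNgt lt_jm.
  by rewrite negbK => /eqP ->; rewrite rmorph0 mul0r.
by exists m, (T m), h; split=> //; apply: IH; exists f.
Qed.

End BoundarySums.

Section BoundaryDependence.
Variables (K : fieldType) (n : nat).
Local Notation S := {mpoly K[n]}.

(** A matrix with more rows than columns has a nonzero row vector in its
    kernel. *)
Lemma linear_relation (r : nat) (E : seq (seq nat)) (f : seq nat -> S)
    (col : 'I_r -> 'X_{1..n}) : (r < size E)%N -> uniq E ->
  exists c : seq nat -> K, (exists2 e, e \in E & c e != 0) /\
    forall j, (\sum_(e <- E) (c e)%:MP * f e)@_(col j) = 0.
Proof.
move=> lt_rE uE.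
pose M := \matrix_(i < size E, j < r) (f (nth [::] E i))@_(col j).
have : kermx M != 0.
  rewrite kermx_eq0 /row_free; apply: contraL lt_rE => /eqP <-.
  by rewrite -leqNgt rank_leq_col.
case/matrix0Pn => i [j Mij]; pose v := row i (kermx M).
have vM : v *m M = 0 by rewrite -row_mul mulmx_ker row0.
pose c e := oapp (v 0) 0 (insub (index e E)).
have cE (k : 'I_(size E)) : c (nth [::] E k) = v 0 k.
  by rewrite /c index_uniq // valK.
exists c; split.
  by exists (nth [::] E j); [rewrite mem_nth | rewrite cE mxE].
move=> k; rewrite (big_nth [::]) big_mkord raddf_sum /=.
have := congr1 (fun A : 'rV_r => A 0 k) vM; rewrite !mxE => vMk.
by rewrite -[RHS]vMk; apply: eq_bigr => l _; rewrite mcoeffCM cE [M _ _]mxE.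
Qed.

Definition deg_le d : pred 'X_{1..n} := fun m => (mdeg m <= d)%N.

Lemma supported_power_product d (s : seq S) N e :
  all (fun a : S => msize a <= d)%N s ->
  e \in exponents (size s) N ->
  supported (deg_le (size s * N * d)) (power_product s e).
Proof.
elim: s e => [|a s IH] e /=.
  by move=> _ _ m; rewrite msupp1 inE => /eqP ->; rewrite /deg_le mdeg0.
move=> /andP[ad sd] /allpairsP[[i f] [iN fE ->]] /=.
apply: (supportedM (B1 := deg_le (i * d))) (IH _ sd fE) => [m1 m2 le1 le2|].
  rewrite /deg_le mdegD mulSn mulnDl leq_add // (leq_trans le1) // leq_mul2r.
  by move: iN; rewrite mem_iota => /andP[_ /ltnW ->]; rewrite orbT.
elim: i {iN fE} => [|i IHi].
  by move=> m; rewrite msupp1 inE => /eqP ->; rewrite /deg_le mdeg0.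
rewrite exprS; apply: (supportedM (B1 := deg_le d)) IHi => [m1 m2 le1 le2|].
  by rewrite /deg_le mdegD mulSn leq_add.
by move=> m /msize_mdeg_lt lt_m; apply: ltnW; apply: leq_trans lt_m ad.
Qed.

Lemma mnm_le_mdeg (m : 'X_{1..n}) i : (m i <= mdeg m)%N.
Proof. by rewrite mdegE (bigD1 i) //= leq_addr. Qed.

Definition outside (W : {set 'I_n}) (m : 'X_{1..n}) :=
  [exists i, (i \notin W) && (m i != 0)%N].

(** More than #|W| polynomials are algebraically dependent once the variables
    outside W are set to zero: the products of powers with exponents less than
    N are N ^ (size s) in number, while the monomials in W of the relevant
    degrees only number O(N ^ #|W|). *)
Lemma boundary_dependence (s : seq S) (W : {set 'I_n}) : (#|W| < size s)%N ->
  exists2 v, boundary s v & supported (outside W) v.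
Proof.
move=> lt_Ws; set k := #|W| in lt_Ws.
pose d := \max_(a <- s) msize (a : S); pose D := (size s * d).+1.
(* N monomials per variable: the N ^ (size s) >= N ^ k.+1 products outnumber
   the (N * D) ^ k = N ^ k * (N - 1) available monomials. *)
pose N := (D ^ k).+1.
pose B := (N * D).-1; have defB : (B.+1 = N * D)%N by [].
pose Q := [pred f : {ffun 'I_n -> 'I_B.+1} | f \in pffun_on ord0 (mem W) predT].
pose col (j : 'I_#|Q|) := [multinom (enum_val j i : nat) | i < n].
have sd : all (fun a : S => msize a <= d)%N s.
  by apply/allP => a a_s; apply: (leq_bigmax_seq (F := fun a : S => msize a)).
have [] := @linear_relation #|Q| (exponents (size s) N) (power_product s) col.
- rewrite size_exponents (@eq_card _ _ (pffun_on ord0 (mem W) predT)) //.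
  rewrite card_pffun_on (eq_card (_ : _ =i 'I_B.+1)) // card_ord defB expnMn -/k.
  apply: (@leq_trans (N ^ k.+1)).
    by rewrite expnSr ltn_mul2l expn_gt0 /= ltnS.
  by rewrite leq_exp2l // ltnS expn_gt0.
- exact: exponents_uniq.
move=> c [nz_c c0].
exists (\sum_(e <- exponents (size s) N) (c e)%:MP * power_product s e).
  exact: boundary_sum.
move=> m m_v; apply: contraT; rewrite negb_exists => /forallP out_m.
have deg_m : (mdeg m <= B)%N.
  have: supported (deg_le (size s * N * d))
      (\sum_(e <- exponents (size s) N) (c e)%:MP * power_product s e).
    rewrite big_seq; apply: big_ind => [||e eE]; first exact: supported0.
      exact: supportedD.
    by rewrite mul_mpolyC; apply: supportedZ; apply: supported_power_product.
  move=> /(_ m m_v) le_m; rewrite -ltnS defB (leq_ltn_trans le_m) //.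
  by rewrite mulnAC mulnC ltn_mul2l ltnSn.
pose f := [ffun i => inord (m i) : 'I_B.+1].
have fE i : f i = m i :> nat.
  by rewrite ffunE inordK // ltnS (leq_trans (mnm_le_mdeg m i)).
have fQ : f \in Q.
  rewrite inE; apply/pffun_onP; split=> //; apply/subsetP => i; rewrite inE.
  apply: contraR => iW; have := out_m i; rewrite iW /= negbK => /eqP mi0.
  by apply/eqP/val_inj; move: (fE i); rewrite mi0.
have colf : col (enum_rank_in fQ f) = m.
  by apply/mnmP => i; rewrite mnmE enum_rankK_in.
by move: m_v; rewrite mcoeff_msupp -colf c0 eqxx.
Qed.

End BoundaryDependence.

(** * Upper bounds for the depth and the dimension of an edge ring *)

Section EdgeRing.
Variables (K : fieldType) (G : graph).
Local Notation S := {mpoly K[#|G|]}.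
Local Notation A := (edge_ring K G).
Local Notation x_ v := (var K v).
Implicit Types (m : 'X_{1..#|G|}) (p : S) (U W D : {set G}).

Definition divides (v : G) m := m (enum_rank v) != 0%N.

(** Membership of a monomial in I + (D), where I is the edge ideal and D a set
    of variables. *)
Definition nonface D m :=
  [exists v in D, divides v m] ||
  [exists x, exists y, [&& adj x y, divides x m & divides y m]].

(** The ideal I + (D). This family is stable under adding a variable and under
    the colon by a variable, which is what the regularity proof inducts on. *)
Definition edges_and D : S -> Prop := supported (nonface D).

Lemma dividesD v m1 m2 : divides v (m1 + m2)%MM = divides v m1 || divides v m2.
Proof. by rewrite /divides mnmDE addn_eq0 negb_and. Qed.

Lemma divides_var v x : divides v U_(enum_rank x)%MM = (v == x).
Proof.
by rewrite /divides mnm1E (inj_eq enum_rank_inj) (eq_sym x); case: (v == x).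
Qed.

Lemma divides_split v m : divides v m -> exists m', m = (m' + U_(enum_rank v))%MM.
Proof.
move=> vm; exists (m - U_(enum_rank v))%MM; rewrite submK //.
by rewrite lep1mP.
Qed.

Lemma nonfaceP D m : reflect
  ((exists2 v, v \in D & divides v m) \/
   exists x y, [/\ adj x y, divides x m & divides y m]) (nonface D m).
Proof.
apply: (iffP orP) => -[].
- by case/exists_inP => v vD vm; left; exists v.
- by case/existsP => x /existsP[y /and3P[? ? ?]]; right; exists x, y.
- by case=> v vD vm; left; apply/exists_inP; exists v.
- case=> x [y [xy xm ym]]; right; apply/existsP; exists x; apply/existsP.
  by exists y; apply/and3P.
Qed.

Lemma nonface_up D : up_closed (nonface D).
Proof.
move=> m m' /nonfaceP[[v vD vm]|[x [y [xy xm ym]]]]; apply/nonfaceP.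
  by left; exists v; rewrite ?dividesD ?vm ?orbT.
by right; exists x, y; rewrite !dividesD xm ym !orbT.
Qed.

Lemma edges_and_ideal D : is_ideal (edges_and D).
Proof. exact/supported_ideal/nonface_up. Qed.

Lemma edge_idealP p : p \in @edge_ideal K G <-> edges_and set0 p.
Proof.
split=> [/asboolP[s [sG ->]]|].
  rewrite big_seq; apply: (ideal_sum _ (edges_and_ideal set0)) => ag.
  case/sG => x [y [xy ->]].
  apply: (ideal_mul (edges_and_ideal _)); rewrite /var -mpolyXD.
  apply/supportedX/nonfaceP; right; exists x, y.
  by rewrite !dividesD !divides_var !eqxx orbT.
apply: (supported_generated (J := fun q => q \in @edge_ideal K G)) => [|m].
  split; first exact: idealr0.
    by move=> a b; apply: rpredD.
  by move=> a b; apply: idealMr.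
case/nonfaceP=> [[v]|[x [y [xy xm ym]]]]; first by rewrite inE.
have [m' def_m] := divides_split xm.
have ym' : divides y m'.
  move: ym; rewrite def_m dividesD divides_var => /orP[//|/eqP yx].
  by move: xy; rewrite yx adj_irr.
have [m'' def_m'] := divides_split ym'.
apply/asboolP; exists [:: ('X_[m''], x_ x * x_ y)]; split.
  by move=> ag; rewrite inE => /eqP -> /=; exists x, y.
by rewrite big_seq1 /= def_m def_m' !mpolyXD -mulrA [x_ x * _]mulrC.
Qed.

(** The quotient map, with the type of the edge ring as codomain so that its
    morphism structure is found for elements of that type. *)
Definition proj (p : S) : A := \pi_({ideal_quot (@edge_ideal K G)}) p.

Fact proj_is_zmod_morphism : zmod_morphism proj.
Proof.
by move=> p q; apply: (raddfB (\pi_({ideal_quot (@edge_ideal K G)}))).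
Qed.

Fact proj_is_monoid_morphism : monoid_morphism proj.
Proof.
split; first exact: (rmorph1 (\pi_({ideal_quot (@edge_ideal K G)}))).
by move=> p q; exact: (rmorphM (\pi_({ideal_quot (@edge_ideal K G)})) p q).
Qed.

HB.instance Definition _ :=
  GRing.isZmodMorphism.Build S A proj proj_is_zmod_morphism.
HB.instance Definition _ :=
  GRing.isMonoidMorphism.Build S A proj proj_is_monoid_morphism.

Lemma proj_eqP p q : proj p = proj q <-> edges_and set0 (p - q).
Proof.
rewrite -edge_idealP; split=> [/eqP|pq]; first by rewrite -Quotient.idealrBE.
by apply/eqP; rewrite -Quotient.idealrBE.
Qed.

Lemma proj_surj (a : A) : exists p, a = proj p.
Proof.
by exists (repr (a : {ideal_quot (@edge_ideal K G)})); rewrite /proj reprK.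
Qed.

Lemma proj_scale p q : p *: proj q = proj (p * q).
Proof. by rewrite rmorphM. Qed.

Lemma in_seq_submodP (s : seq S) p :
  in_seq_submod s (proj p) <-> add_gens (edges_and set0) s p.
Proof.
rewrite add_gensP; split=> [[c def_p]|[c /proj_eqP def_p]].
  have [f cf] := choice (fun i => proj_surj (c i)); exists f; apply/proj_eqP.
  rewrite def_p raddf_sum; apply: eq_bigr => i _.
  by rewrite cf proj_scale.
exists (fun i => proj (c i)); rewrite def_p raddf_sum.
by apply: eq_bigr => i _; rewrite proj_scale.
Qed.

Lemma regular_seqP (s : seq S) : @regular_seq _ A s <->
  regular_over (edges_and set0) s /\ exists p, ~ add_gens (edges_and set0) s p.
Proof.
rewrite regular_over_nth; split=> -[rs [x nx]]; split.
- move=> i lt_is p /in_seq_submodP sp; apply/in_seq_submodP.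
  by apply: rs => //; rewrite proj_scale.
- have [p def_x] := proj_surj x; exists p.
  apply: contra_not nx => /in_seq_submodP.
  by rewrite -def_x.
- move=> i lt_is a; have [p ->] := proj_surj a; rewrite proj_scale.
  by move=> /in_seq_submodP /(rs _ lt_is) ?; apply/in_seq_submodP.
by exists (proj x); apply: contra_not nx => /in_seq_submodP.
Qed.

Definition deg_ge t : pred 'X_{1..#|G|} := fun m => (t <= mdeg m)%N.

Lemma deg_ge_up t : up_closed (deg_ge t).
Proof. by move=> m m' dm; rewrite /deg_ge mdegD (leq_trans dm) ?leq_addl. Qed.

Lemma irrelevant_supported p :
  p \in @irrelevant_ideal K G -> supported (deg_ge 1) p.
Proof.
move=> /asboolP[s [sG ->]]; rewrite big_seq.
have i1 := supported_ideal K (@deg_ge_up 1).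
apply: (ideal_sum _ i1) => ag /sG[v ->].
by apply: (ideal_mul i1); apply/supportedX; rewrite /deg_ge mdeg1.
Qed.

Lemma irrelevant_exp_supported p t :
  p \in @irrelevant_ideal K G -> supported (deg_ge t) (p ^+ t).
Proof.
move=> /irrelevant_supported p1; elim: t => [|t IH] //.
rewrite exprS; apply: supportedM p1 IH => m1 m2 d1 d2.
by rewrite /deg_ge mdegD (leq_add d1 d2).
Qed.

Definition independent W := {in W &, forall x y, ~~ adj x y}.

(** For an independent set, this is maximality under inclusion. *)
Definition dominating W := forall v, v \notin W -> exists2 w, w \in W & adj v w.

Definition indicator W : 'X_{1..#|G|} :=
  [multinom nat_of_bool (enum_val i \in W) | i < #|G|].

Lemma divides_indicator W v : divides v (indicator W) = (v \in W).
Proof. by rewrite /divides mnmE enum_rankK; case: (v \in W). Qed.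

(** Let z be the product of the variables of W. By maximality of W every
    variable outside W kills z modulo I. If s is longer than W, then for every t
    some boundary element of the powers s ^ t is supported outside W, hence
    kills z; as the powers are again regular, z lies in I + (s ^ t), and so in
    I + m ^ t for the irrelevant ideal m. This fails when t exceeds the degree
    of z, as W is a face. *)
Lemma depth_le_dominating (s : seq S) W : independent W -> dominating W ->
  {subset s <= @irrelevant_ideal K G} -> @regular_seq _ A s ->
  (size s <= #|W|)%N.
Proof.
move=> indW domW sm /regular_seqP[reg_s _]; rewrite leqNgt; apply/negP => lt_Ws.
pose z : S := 'X_[indicator W]; pose t := (mdeg (indicator W)).+1.
pose st := [seq a ^+ t | a <- s].
(* boundary elements of the powers of s, not of s: this is what pushes z into
   every power of the irrelevant ideal *)
have [|v bv outv] := @boundary_dependence K #|G| st [set enum_rank w | w in W].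
  by rewrite card_imset ?size_map //; apply: enum_rank_inj.
have : add_gens (edges_and set0) st z.
  apply: boundary_regular bv _; first exact: edges_and_ideal.
    by apply: regular_over_exp => //; apply: edges_and_ideal.
  apply: supportedM (pred1 (indicator W)) _ _ _ _ outv _; last first.
    by apply/supportedX; rewrite /= eqxx.
  move=> m1 m2 /existsP[i /andP[iW m1i]] /eqP ->.
  have [|w wW adj_w] := domW (enum_val i).
    apply: contra iW => iW; apply/imsetP.
    by exists (enum_val i); rewrite ?enum_valK.
  apply/nonfaceP; right; exists (enum_val i), w.
  split=> //; rewrite dividesD; first by rewrite /divides enum_valK m1i.
  by rewrite divides_indicator wW orbT.
pose B m := nonface set0 m || deg_ge t m.
have upB : up_closed B.
  by move=> m m' /orP[nm|dm]; apply/orP;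
    [left; apply: nonface_up | right; apply: deg_ge_up].
move=> /(add_gens_min (supported_ideal K upB)) Bz.
have /supportedX : supported B z.
  apply: Bz => [p Ip m /Ip nm|a /mapP[b bs ->] m]; first by rewrite /B nm.
  by move/(irrelevant_exp_supported (sm b bs)) => dm; rewrite /B dm orbT.
rewrite /B /deg_ge ltnn orbF => /nonfaceP[[x]|[x [y]]]; first by rewrite inE.
by rewrite !divides_indicator => -[xy xW yW]; have := indW x y xW yW; rewrite xy.
Qed.

(** The variables outside the first prime of a chain form an independent set
    W, since a product over an edge is zero. If the chain were longer than W,
    elements separating consecutive primes would be algebraically dependent
    modulo the variables outside W, which all lie in the first prime; this
    contradicts [boundary_chain]. *)
Lemma krull_dim_le d n (P : 'I_n.+1 -> prime_idealr A) :
  (forall W, independent W -> (#|W| <= d)%N) -> prime_chain P -> (n <= d)%N.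
Proof.
move=> dW chP; rewrite leqNgt; apply/negP => lt_dn.
pose W := [set v : G | proj (x_ v) \notin P ord0].
have indW : independent W.
  move=> x y; rewrite !inE => Px Py; apply/negP => xy.
  have /proj_eqP : edges_and set0 (x_ x * x_ y - 0).
    rewrite subr0; apply/edge_idealP/asboolP; exists [:: (1, x_ x * x_ y)].
    split; first by move=> ag; rewrite inE => /eqP -> /=; exists x, y.
    by rewrite big_seq1 mul1r.
  rewrite rmorphM rmorph0 => xy0.
  by have := prime_idealrM (P ord0) (proj (x_ x)) (proj (x_ y));
    rewrite xy0 (negPf Px) (negPf Py) idealr0.
have [|f fP] := @choice nat S (fun i p => (i < n)%N ->
    proj p \in P (inord i.+1) /\ proj p \notin P (inord i)).
  move=> i.
  have [lt_in|] := boolP (i < n)%N; last by exists 0.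
  have [|_ [a Pa nPa]] := chP (inord i) (inord i.+1).
    by rewrite !inordK // ltnS ltnW.
  by have [p def_a] := proj_surj a; exists p; rewrite -def_a.
have [|v bv outv] :=
  @boundary_dependence K #|G| (mkseq f n) [set enum_rank w | w in W].
  rewrite size_mkseq card_imset; last exact: enum_rank_inj.
  by apply: leq_ltn_trans (dW _ indW) lt_dn.
have iP i : is_ideal (fun p : S => proj p \in P i).
  split=> [|p q|a p]; first by rewrite rmorph0 idealr0.
    by rewrite rmorphD; apply: rpredD.
  by rewrite rmorphM; apply: idealMr.
apply: (boundary_chain (P := fun i p => proj p \in P (inord i))) bv _ => //.
- by move=> i _; rewrite rmorph1 idealr1.
- by move=> i p q _; rewrite rmorphM prime_idealrM => /orP.
- rewrite size_mkseq => i p lt_in; have [|PP _] := chP (inord i) (inord i.+1).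
    by rewrite !inordK // ltnS ltnW.
  exact: PP.
- rewrite size_mkseq => i lt_in; rewrite nth_mkseq //.
  by have [? /negP] := fP i lt_in.
apply: supported_generated (iP _) _ _ outv => m /existsP[i /andP[iW mi]].
have iP0 : proj (x_ (enum_val i)) \in P ord0.
  apply: contraR iW => iP0; apply/imsetP.
  exists (enum_val i); last by rewrite enum_valK.
  by rewrite inE.
have [|m' ->] := @divides_split (enum_val i) m.
  by rewrite /divides enum_valK.
have -> : inord 0 = ord0 :> 'I_n.+1 by apply/val_inj; rewrite /= inordK.
by rewrite mpolyXD rmorphM; apply: idealMr.
Qed.

End EdgeRing.

(** * Lower bound for the dimension of an edge ring *)

Lemma prime_idealr_of (R : comNzRingType) (J : R -> Prop) :
  is_ideal J -> ~ J 1 ->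
  (forall x y, J (x * y) -> J x \/ J y) ->
  exists P : prime_idealr R, forall x, x \in P <-> J x.
Proof.
move=> iJ J1 Jp; pose Q : {pred R} := fun x => `[< J x >].
have QP x : x \in Q <-> J x by split=> [/asboolP|Jx] //; apply/asboolP.
have Qi : idealr_closed Q.
  split; first by apply/QP; apply: ideal_zero.
    by apply/negP => /QP.
  move=> a x y /QP Jx /QP Jy; apply/QP.
  by apply: ideal_add => //; apply: ideal_mul.
have Qp : prime_idealr_closed Q.
  by move=> x y /QP /Jp[/QP -> | /QP ->] //; rewrite orbT.
pose P : prime_idealr R := HB.pack Q (isIdealr.Build _ _ Qi)
  (isPrimeIdealrClosed.Build _ _ Qp).
by exists P.
Qed.

Section PrimeChains.
Variables (K : fieldType) (G : graph).
Local Notation S := {mpoly K[#|G|]}.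
Local Notation A := (edge_ring K G).
Implicit Types (U W : {set G}) (m : 'X_{1..#|G|}).

Definition meets U m := [exists v in U, divides v m].

Lemma meets_up U : up_closed (meets U).
Proof.
move=> m m' /exists_inP[v vU vm]; apply/exists_inP; exists v => //.
by rewrite dividesD vm orbT.
Qed.

Lemma meets_prime U p q : supported (meets U) (p * q : S) ->
  supported (meets U) p \/ supported (meets U) q.
Proof.
apply: supported_prime; first exact: meets_up.
move=> m1 m2 /exists_inPn nm1 /exists_inPn nm2; apply/exists_inPn => v vU.
by rewrite dividesD negb_or nm1 ?nm2.
Qed.

Lemma var_prime U : (forall x y, adj x y -> (x \in U) || (y \in U)) ->
  exists P : prime_idealr A,
    forall p : S, proj p \in P <-> supported (meets U) p.
Proof.
move=> covU; have iU := supported_ideal K (@meets_up U).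
have edgesU (p : S) : edges_and set0 p -> supported (meets U) p.
  move=> Ip m /Ip /nonfaceP[[v]|[x [y [xy xm ym]]]]; first by rewrite inE.
  by apply/exists_inP; have /orP[] := covU x y xy; [exists x|exists y].
pose J (a : A) := exists2 p : S, supported (meets U) p & a = proj p.
have JP (p : S) : J (proj p) <-> supported (meets U) p.
  split=> [[q Uq /proj_eqP /edgesU Upq]|]; last by exists p.
  by rewrite -(subrK q p); apply: supportedD.
have [||x y|P PJ] := @prime_idealr_of A J.
- split=> [|a b [p Up ->] [q Uq ->]|a b [p Up ->]].
  + by rewrite -(rmorph0 (@proj K G)); apply/JP; exact: (ideal_zero iU).
  + by rewrite -rmorphD; apply/JP; apply: (ideal_add iU).
  + have [q ->] := proj_surj a.
    by rewrite -rmorphM; apply/JP; apply: (ideal_mul iU).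
- rewrite -(rmorph1 (@proj K G)) JP => /(_ 0%MM).
  rewrite msupp1 mem_head => /(_ isT).
  by move=> /exists_inP[v _]; rewrite /divides mnm0E.
- have [p ->] := proj_surj x; have [q ->] := proj_surj y.
  by rewrite -rmorphM !JP; apply: meets_prime.
by exists P => p; rewrite PJ JP.
Qed.

(** Start from the cover complementary to W and add the vertices of W one at a
    time. *)
Lemma krull_dim_ge W : independent W ->
  exists P : 'I_#|W|.+1 -> prime_idealr A, prime_chain P.
Proof.
move=> indW; pose U i := [set v | (v \notin W) || (index v (enum W) < i)%N].
have [|P PU] := @choice _ _ (fun (i : 'I_#|W|.+1) (P : prime_idealr A) =>
    forall p : S, proj p \in P <-> supported (meets (U i)) p).
  move=> i; apply: var_prime => x y xy; rewrite !inE.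
  have [xW|//] := boolP (x \in W); have [yW|] := boolP (y \in W).
    by have := indW x y xW yW; rewrite xy.
  by rewrite orbT.
exists P => i j lt_ij; split.
  move=> a; have [p ->] := proj_surj a => /PU Up; apply/PU => m /Up.
  case/exists_inP => v; rewrite inE => vU vm; apply/exists_inP; exists v => //.
  rewrite inE; case/orP: vU => [->//|lt_vi].
  by rewrite (ltn_trans lt_vi lt_ij) orbT.
have lt_iW : (i < #|W|)%N by apply: leq_trans lt_ij (leq_ord j).
pose w := enum_val (Ordinal lt_iW).
have w_i : index w (enum W) = i.
  by rewrite /w /enum_val index_uniq ?enum_uniq // -cardE.
exists (proj (var K w)).
  apply/PU/supportedX/exists_inP; exists w; last by rewrite divides_var.
  by rewrite inE w_i lt_ij orbT.
apply/negP => /PU /supportedX /exists_inP[v].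
rewrite divides_var inE => vU /eqP vw.
by move: vU; rewrite vw w_i ltnn orbF /w enum_valP.
Qed.

End PrimeChains.

(** * A regular sequence attached to a partition into cliques *)

Section VariableOperations.
Variables (K : fieldType) (G : graph).
Local Notation S := {mpoly K[#|G|]}.
Local Notation x_ v := (var K v).
Local Notation edges_and := (@edges_and K G).
Implicit Types (D : {set G}) (v w : G).

Definition neighbours v : {set G} := [set w | adj v w].

Lemma nonfaceU1 v D m : nonface (v |: D) m = divides v m || nonface D m.
Proof.
apply/nonfaceP/idP => [[[w]|edge]|/orP[vm|/nonfaceP[[w wD wm]|edge]]].
- rewrite !inE => /orP[/eqP -> -> //|wD wm]; apply/orP; right.
  by apply/nonfaceP; left; exists w.
- by apply/orP; right; apply/nonfaceP; right.
- by left; exists v; rewrite // !inE eqxx.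
- by left; exists w; rewrite // !inE wD orbT.
- by right.
Qed.

Lemma add_gen_var v D : add_gen (edges_and D) (x_ v) = edges_and (v |: D).
Proof.
apply/funext => p; apply/propext; split.
  apply: add_gen_min; first exact: edges_and_ideal.
    by move=> q Dq m /Dq Dm; rewrite nonfaceU1 Dm orbT.
  by apply/supportedX; rewrite nonfaceU1 divides_var eqxx.
have iJ := add_gen_ideal (x_ v) (edges_and_ideal K D).
apply: (supported_generated iJ) => m; rewrite nonfaceU1 => /orP[vm|Dm].
  have [m' ->] := divides_split vm.
  by rewrite mpolyXD mulrC; apply/add_gen_gen/edges_and_ideal.
exact/add_gen_sub/supportedX.
Qed.

(** The monomial form of (I + (D)) : x_v = I + (D) + (neighbours of v). *)
Lemma nonface_shift v D m : v \notin D ->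
  nonface D (m + U_(enum_rank v))%MM = nonface (D :|: neighbours v) m.
Proof.
move=> vD; apply/nonfaceP/nonfaceP =>
  [[[w wD]|[x [y [xy]]]]|[[w]|[x [y [xy xm ym]]]]].
- rewrite dividesD divides_var => /orP[wm|/eqP wv]; last by rewrite -wv wD in vD.
  by left; exists w; rewrite // inE wD.
- rewrite !dividesD !divides_var => /orP[xm|/eqP xv] /orP[ym|/eqP yv].
  + by right; exists x, y.
  + by left; exists x; rewrite // !inE -yv adj_sym xy orbT.
  + by left; exists y; rewrite // !inE -xv xy orbT.
  + by move: xy; rewrite xv yv adj_irr.
- rewrite !inE => /orP[wD|vw] wm; first by left; exists w; rewrite ?dividesD ?wm.
  by right; exists v, w; rewrite !dividesD divides_var eqxx wm orbT.
- by right; exists x, y; rewrite !dividesD xm ym.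
Qed.

Lemma colon_var v D : v \notin D ->
  colon (edges_and D) (x_ v) = edges_and (D :|: neighbours v).
Proof.
move=> vD; apply/funext => p; apply/propext; rewrite /colon; split=> Dp m.
  move=> mp; rewrite -nonface_shift //; apply: Dp.
  by rewrite mcoeff_msupp /var addmC mcoeffMX -mcoeff_msupp.
move=> /msuppM_le /allpairsP[[m1 m2] [/Dp Dm1]].
rewrite /var msuppX inE => /eqP /= -> ->.
by rewrite nonface_shift.
Qed.

End VariableOperations.

Section CliquePartition.
Variables (K : fieldType) (G : graph) (I : finType) (c : G -> I).
Hypothesis clique : forall u v, c u = c v -> u != v -> adj u v.
Local Notation S := {mpoly K[#|G|]}.
Local Notation x_ v := (var K v).
Local Notation edges_and := (@edges_and K G).
Implicit Types (D : {set G}).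

Definition class_sum (i : I) : S := \sum_(v | c v == i) x_ v.

Lemma class_sum_survivor D i v : c v = i ->
  (forall w, c w = i -> w != v -> w \in D) -> edges_and D (class_sum i - x_ v).
Proof.
move=> cv onlyv; rewrite /class_sum (bigD1 v) ?cv //= addrAC subrr add0r.
apply: (ideal_sum _ (edges_and_ideal K D)) => w /andP[/eqP cw wv].
by apply/supportedX/nonfaceP; left; exists w; rewrite ?divides_var ?onlyv.
Qed.

(** If D is a vertex cover and leaves one vertex in each class, the class sums
    are distinct variables of a polynomial ring modulo I + (D). *)
Lemma regular_class_sums_edgeless D (s : seq I) : uniq s ->
  (forall x y, adj x y -> (x \in D) || (y \in D)) ->
  (forall i, i \in s -> exists v, [/\ c v = i, v \notin D &
     forall w, c w = i -> w != v -> w \in D]) ->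
  regular_over (edges_and D) [seq class_sum i | i <- s].
Proof.
elim: s D => //= i s IH D /andP[i_s uniq_s] covD survD.
have iD := edges_and_ideal K D.
have meetsD p : edges_and D p <-> supported (meets D) p.
  split=> Dp m /Dp; last by move=> Dm; apply/orP; left.
  case/orP=> // /existsP[x /existsP[y /and3P[xy xm ym]]].
  by apply/exists_inP; have /orP[] := covD x y xy; [exists x|exists y].
have [|v [cv vD onlyv]] := survD i; first exact: mem_head.
have Dcv := class_sum_survivor cv onlyv.
split=> [p Dp|].
  have /meetsD /meets_prime[/supportedX /exists_inP[w wD]|/meetsD //] :
      edges_and D (x_ v * p).
    have -> : x_ v * p = class_sum i * p - p * (class_sum i - x_ v) by ring.
    by apply: (ideal_sub iD) => //; apply: (ideal_mul iD).
  by rewrite divides_var => /eqP wv; rewrite -wv wD in vD.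
rewrite (add_gen_congr iD Dcv) add_gen_var; apply: IH => //.
  by move=> x y /covD /orP[] xD; rewrite !inE xD !orbT.
move=> j js; have [|w [cw wD onlyw]] := survD j; first by rewrite inE js orbT.
exists w; split=> //; last by move=> u cu uw; rewrite inE onlyw ?orbT.
rewrite !inE negb_or wD andbT; apply: contraNneq i_s => wv.
by rewrite -cv -wv cw.
Qed.

(** Vertices of D are deleted; the hypothesis asks that every class keep a
    vertex whose surviving neighbours all lie in that class. If a class keeps a
    vertex x besides such a vertex h, the colon and the sum with x_x delete the
    neighbours of x (leaving x alone in its class) and x itself respectively;
    both preserve the hypothesis and have fewer survivors. The class sums of
    cliques partitioning a graph are thus a regular sequence as soon as each
    clique contains a simplicial vertex. *)
Lemma regular_class_sums D :
  (forall i, exists v, [/\ c v = i, v \notin D &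
     forall w, adj v w -> (w \in D) || (c w == i)]) ->
  regular_over (edges_and D) [seq class_sum i | i <- enum I].
Proof.
have [k] := ubnP #|~: D|; elim: k => // k IH in D * => ltDk survD.
have grow D' x : D \subset D' -> x \notin D -> x \in D' -> (#|~: D'| < k)%N.
  move=> sDD' xD xD'; rewrite -ltnS; apply: leq_trans ltDk; rewrite ltnS.
  apply/proper_card/properP; split; first by rewrite setCS.
  by exists x; rewrite !inE ?xD ?xD'.
have [[i [u [v [cu cv uD vD uv]]]]|single] := pselect (exists i u v,
  [/\ c u = i, c v = i, u \notin D, v \notin D & u != v]); last first.
  have surv1 i : exists v, [/\ c v = i, v \notin D &
      forall w, c w = i -> w != v -> w \in D].
    have [v [cv vD _]] := survD i; exists v; split=> // w cw wv.
    by apply/negPn/negP => wD; apply: single; exists i, w, v.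
  apply: regular_class_sums_edgeless => [|x y xy|i _]; first exact: enum_uniq.
    have [//|xD] := boolP (x \in D).
    have [v [cv vD vnb]] := survD (c x).
    have vx : x = v.
      by apply/eqP/negPn/negP => xv; apply: single; exists (c x), x, v.
    have := vnb y; rewrite -vx => /(_ xy)/orP[-> //|/eqP cyx].
    have [//|yD] := boolP (y \in D).
    exfalso; apply: single; exists (c x), x, y; split=> //.
    by apply: contraTneq xy => ->; rewrite adj_irr.
  exact: surv1.
have [h [ch hD hnb]] := survD i.
have [x [cx xD xh]] : exists x, [/\ c x = i, x \notin D & x != h].
  by have [uh|uh] := eqVneq u h; [exists v; rewrite -uh eq_sym | exists u].
apply: (@regular_over_colon _ _ (x_ x)); first exact: edges_and_ideal.
  rewrite colon_var //; apply: IH => [|j].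
    apply: (grow _ h); rewrite ?subsetUl // !inE clique ?orbT ?cx //.
  (* x is now simplicial: all its neighbours have been deleted *)
  have [ji|ji] := eqVneq j i.
    exists x; rewrite cx ji; split=> //; first by rewrite !inE negb_or xD adj_irr.
    by move=> w xw; rewrite !inE xw orbT.
  have [g [cg gD gnb]] := survD j; exists g; split=> //.
    rewrite !inE negb_or gD /=; apply/negP => xg.
    have := gnb x; rewrite adj_sym xg (negPf xD) /= cx => /(_ isT) /eqP ij.
    by rewrite ij eqxx in ji.
  by move=> w /gnb /orP[wD|->]; rewrite ?inE ?wD ?orbT.
rewrite add_gen_var; apply: IH => [|j].
  by apply: (grow _ x); rewrite ?subsetUr // !inE eqxx.
have [g [cg gD gnb gx]] : exists g, [/\ c g = j, g \notin D,
    forall w, adj g w -> (w \in D) || (c w == j) & g != x].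
  have [ji|ji] := eqVneq j i; first by exists h; rewrite ji eq_sym.
  have [g [cg gD gnb]] := survD j; exists g; split=> //.
  by apply: contraNneq ji => gx; rewrite -cg gx cx.
exists g; split=> //; first by rewrite !inE negb_or gx.
by move=> w /gnb /orP[wD|->]; rewrite ?inE ?wD ?orbT.
Qed.

End CliquePartition.

(** * Corona products *)

Lemma maximal_independent (G : graph) (B0 : {set G}) : independent B0 ->
  exists B : {set G}, [/\ independent B, dominating B & B0 \subset B].
Proof.
pose ind := [pred B : {set G} | [forall x in B, forall y in B, ~~ adj x y]].
have indP (B : {set G}) : reflect (independent B) (ind B).
  apply: (iffP forall_inP) => indB x.
    by move=> y xB yB; apply: (forall_inP (indB x xB)).
  by move=> xB; apply/forall_inP => y; apply: indB.
move=> /indP /(@maxset_exists _ ind)[B /maxsetP[/indP indB maxB] sB0B].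
exists B; split=> // v vB; apply/exists_inP; apply: contraR vB => /exists_inPn nv.
rewrite -(maxB (v |: B)) ?setU11 ?subsetUr //; apply/indP => x y.
rewrite !inE => /orP[/eqP ->|xB] /orP[/eqP ->|yB]; rewrite ?adj_irr ?nv //.
  by rewrite adj_sym nv.
exact: indB.
Qed.

Section Corona.
Variables (K : fieldType) (X H : graph).
Local Notation XH := (corona X H).
Local Notation S := {mpoly K[#|XH|]}.
Implicit Types (B : {set H}).

Definition centre (a : XH) : X := match a with inl x => x | inr (x, _) => x end.

Definition spread (Y : {set X}) B : {set XH} :=
  [set (inr p : XH) | p in setX Y B].

Lemma card_spread Y B : #|spread Y B| = (#|Y| * #|B|)%N.
Proof. by rewrite card_imset ?cardsX // => p q []. Qed.

Lemma mem_spread Y B x h :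
  ((inr (x, h) : XH) \in spread Y B) = (x \in Y) && (h \in B).
Proof. by rewrite mem_imset ?inE // => p q []. Qed.

Lemma mem_spread_inl Y B x : ((inl x : XH) \in spread Y B) = false.
Proof. by apply/negP => /imsetP[]. Qed.

Lemma spread_independent Y B : independent B -> independent (spread Y B).
Proof.
move=> indB [x|[x h]] [y|[y k]]; rewrite ?mem_spread_inl // !mem_spread.
move=> /andP[_ hB] /andP[_ kB] /=.
by rewrite negb_and indB ?orbT.
Qed.

Lemma corona_clique : is_complete H ->
  forall u v : XH, centre u = centre v -> u != v -> adj u v.
Proof.
move=> cH [x|[x h]] [y|[y k]] /= -> => [||| hk]; rewrite ?eqxx //=.
by apply: cH; apply: contraNneq hk => ->.
Qed.

Lemma independent_corona_le (W : {set XH}) : is_complete H -> independent W ->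
  (#|W| <= #|X|)%N.
Proof.
move=> cH indW; rewrite -(card_in_imset (f := centre)) ?max_card //.
move=> u v uW vW cuv.
apply/eqP; apply: contraNT (indW u v uW vW) => uv.
exact: corona_clique.
Qed.

(** The fibres of centre are cliques, and the vertices of H are simplicial, so
    the #|X| sums over these cliques form a regular sequence. One vertex in each
    copy of H gives a maximal independent set, which settles the upper bound for
    the depth and the lower bound for the dimension. *)
Lemma cohen_macaulay_corona_complete : (0 < #|H|)%N -> is_complete H ->
  cohen_macaulay_edge_ring K XH.
Proof.
case/card_gt0P => h0 _ cH; pose W := spread setT [set h0].
have cardW : #|W| = #|X| by rewrite card_spread cards1 muln1 cardsT.
have indW : independent W.
  apply: spread_independent => h k; rewrite !inE => /eqP -> /eqP ->.
  by rewrite adj_irr.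
have domW : dominating W.
  move=> [x|[x h]]; rewrite ?mem_spread_inl ?mem_spread ?inE /= => hh.
    by exists (inr (x, h0)); rewrite ?mem_spread ?inE ?eqxx.
  by exists (inr (x, h0)); [rewrite mem_spread !inE eqxx | rewrite /= eqxx cH].
exists #|W|; split; split.
- pose s := [seq class_sum K centre i | i <- enum X].
  have sm : {subset s <= @irrelevant_ideal K XH}.
    move=> a /mapP[i _ ->]; apply/asboolP.
    exists [seq (1, var K v) | v <- enum XH & centre v == i]; split.
      by move=> ag /mapP[v _ ->]; exists v.
    rewrite big_map big_filter big_enum_cond.
    by apply: eq_bigr => v _; rewrite mul1r.
  exists s; split=> //; last by rewrite size_map -cardE cardW.
  apply/regular_seqP; split.
    apply: regular_class_sums => [|i]; first exact: corona_clique.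
    exists (inr (i, h0)); rewrite inE; split=> // -[y|[y k]] /=; rewrite inE /=.
      by rewrite eq_sym.
    by case/andP=> /eqP ->.
  exists 1 => s1.
  have /(_ 0%MM) : supported (@deg_ge XH 1) (1 : S).
    apply: add_gens_min s1; first exact/supported_ideal/deg_ge_up.
      move=> p Ip m /Ip /nonfaceP[[v]|[x [y [_ xm _]]]]; first by rewrite inE.
      rewrite /deg_ge lt0n mdeg_eq0; apply: contraNneq xm => ->.
      by rewrite /divides mnm0E.
    by move=> a /sm /irrelevant_supported.
  by rewrite msupp1 mem_head /deg_ge mdeg0 => /(_ isT).
- by move=> s sm; apply: depth_le_dominating.
- exact: krull_dim_ge.
- move=> n P; apply: krull_dim_le => W' indW'; rewrite cardW.
  exact: independent_corona_le.
Qed.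

(** Two nonadjacent vertices of H extend to a maximal independent set B of H.
    Spreading B over all copies of H gives an independent set of size
    #|X| * #|B|; replacing one copy of B by the vertex of X it is attached to
    gives a maximal independent set of size 1 + (#|X| - 1) * #|B|. The former
    bounds the dimension from below, the latter the depth from above. *)
Lemma complete_of_cohen_macaulay_corona : (0 < #|X|)%N ->
  cohen_macaulay_edge_ring K XH -> is_complete H.
Proof.
case/card_gt0P => x0 _ [d [[[s [sm reg_s size_s]] _] [_ dimd]]] h k hk.
apply/negPn/negP => nhk.
have [|B [indB domB]] := @maximal_independent H [set h; k].
  move=> a b; rewrite !inE => /orP[] /eqP -> /orP[] /eqP ->;
    by rewrite ?adj_irr // adj_sym.
rewrite subUset !sub1set => /andP[hB kB].
have cardB : (1 < #|B|)%N.
  have := subset_leq_card (_ : [set h; k] \subset B); rewrite cards2 hk; apply.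
  by rewrite subUset !sub1set hB.
have [P chP] := krull_dim_ge K (spread_independent (Y := setT) indB).
have := dimd _ _ chP; rewrite card_spread cardsT => le_d.
pose W2 : {set XH} := (inl x0 : XH) |: spread (~: [set x0]) B.
have indW2 : independent W2.
  move=> u v /setU1P[->|uW] /setU1P[->|vW]; first by rewrite adj_irr.
  - case: v vW => [y|[y l]]; rewrite ?mem_spread_inl // mem_spread !inE.
    by case/andP; rewrite eq_sym.
  - case: u uW => [y|[y l]]; rewrite ?mem_spread_inl // mem_spread !inE.
    by case/andP; rewrite eq_sym.
  - exact: (spread_independent indB uW vW).
have domW2 : dominating W2.
  have memW2 x b : x != x0 -> b \in B -> (inr (x, b) : XH) \in W2.
    by move=> xx0 bB; rewrite inE mem_spread !inE xx0 bB orbT.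
  have x0W2 : (inl x0 : XH) \in W2 by rewrite setU11.
  move=> [x|[x l]] vW2; have [xx0|xx0] := eqVneq x x0.
  - by rewrite xx0 x0W2 in vW2.
  - by exists (inr (x, h)); [apply: memW2 | rewrite /= eqxx].
  - by exists (inl x0); rewrite //= xx0.
  have [|b bB lb] := domB l; first by apply: contra vW2; apply: memW2.
  by exists (inr (x, b)); [apply: memW2 | rewrite /= eqxx].
have := depth_le_dominating indW2 domW2 sm reg_s.
rewrite cardsU1 mem_spread_inl card_spread size_s => /(leq_trans le_d).
have -> : #|X| = #|~: [set x0]|.+1 by rewrite -(cardsC [set x0]) cards1.
by rewrite mulSn leq_add2r leqNgt cardB.
Qed.

End Corona.

Lemma special_graph_nonempty X : special_graph X -> (0 < #|X|)%N.
Proof.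
case=> [n n1|n n3|n n1|n|u v u1 _] [f [g _ _] _]; apply/card_gt0P.
- by exists (g (Ordinal n1)).
- by exists (g (Ordinal (ltnW (ltnW n3)))).
- by exists (g (Ordinal n1)).
- by exists (g None).
by exists (g (inl (Ordinal u1))).
Qed.

Theorem theorem3p4 (K : fieldType) (X H : graph)
    (hX : special_graph X) (hH : (0 < #|H|)%N) :
  cohen_macaulay_edge_ring K (corona X H) <-> is_complete H.
Proof.
split; first exact/complete_of_cohen_macaulay_corona/special_graph_nonempty.
exact: cohen_macaulay_corona_complete.
Qed.
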